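(* Let $n\ge 2$ and let $\Omega\subset\mathbb{C}^n$ be a bounded domain with $C^1$ boundary. Let $p\in\partial\Omega$, let $N_p$ be the unit outward normal vector at $p$, and let $L_p$ be a unit complex tangential vector at $p$. Suppose that $\Omega$ satisfies the disc property of index $k$ along $L_p$ at $p$ for some $k\in\mathbb{Z}^+$. Let $0<\alpha<1/k$ and let $f$ be a holomorphic function on $\Omega$ that is Lipschitz of order $\alpha$ on $\Omega$. Then $f$ is Lipschitz of order $k\alpha$ along the direction $L_p$ at $Q:=p-\delta N_p$ for sufficiently small $\delta>0$, in the following precise sense: there exist constants $c,C>0$ such that $$\left|f(p-\delta N_p)-f(p-\delta N_p+hL_p)\right|\le C|h|^{k\alpha}$$ for all $\delta>0$ sufficiently small and all $h\in\mathbb{C}$ with $|h|<\frac{c\,\delta^{1/k}}{10}$.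
   Context: Real tangent vectors and complex tangential vectors at $p\in\partial\Omega$ are identified with vectors in $\mathbb{C}^n$, so that they can be multiplied by complex scalars and added to points. A complex tangential vector at $p$ is a vector in the complex tangent space of $\partial\Omega$ at $p$, i.e. the maximal complex subspace of the real tangent space $T_p\partial\Omega$ (equivalently, the vectors Hermitian-orthogonal to $N_p$). Disc property of index $k$: let $\Omega\subset\mathbb{C}^n$ ($n\ge2$) be a domain with $C^1$ boundary, $k\in\mathbb{Z}^+$, $p\in\partial\Omega$, $N_p$ the unit outward normal vector and $L_p$ a unit complex tangential vector at $p$. $\Omega$ is said to satisfy the disc property of index $k$ along $L_p$ at $p$ if there are $\delta_p>0$, $c_1>0$, $c_2>0$ such that for every $0<\delta\le\delta_p$, with $Q=p-\delta N_p$, $$\left\{Q-w_1N_p+w_2L_p:\ (w_1,w_2)\in W^{1/k}\right\}\subset\Omega,$$ where $W^{1/k}:=\{(w_1,w_2)\in\mathbb{C}^2: |w_1|\le c_1\delta,\ |w_2|\le c_2\delta^{1/k}\}$. A function $f$ on $\Omega$ is Lipschitz of order $\alpha$ (written $f\in C^\alpha(\Omega)$) if there is a constant $K$ with $|f(z)-f(w)|\le K|z-w|^\alpha$ for all $z,w\in\Omega$. *)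

(* Defs.v *)
From HB Require Import structures.
From mathcomp Require Export all_boot all_order all_algebra.
From mathcomp Require Export complex.
From mathcomp Require Export all_classical all_reals all_analysis.
Export Order.TTheory GRing.Theory Num.Theory.
Export numFieldNormedType.Exports.
Export ComplexField.Normc.

Set Implicit Arguments.
Unset Strict Implicit.
Unset Printing Implicit Defensive.

Local Open Scope classical_set_scope.
Local Open Scope complex_scope.
Local Open Scope ring_scope.

(* The topology given by the modulus; ['rV[R[i]]_n] then carries the product
   topology, which is the usual topology of C^n. *)
HB.instance Definition _ (R : realType) := NormedModule.copy R[i] R[i]^o.

Section ComplexSpace.
Context {R : realType} {n : nat}.
Local Notation Cn := 'rV[R[i]]_n.

(* The Euclidean norm; the library norm on ['rV_n] is the R[i]-valued sup norm. *)
Definition enorm (z : Cn) : R := Num.sqrt (\sum_j normc (z 0 j) ^+ 2).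

(* The identification C^n = R^n x R^n, through which real differentiability
   of functions on C^n is expressed. *)
Definition ReIm (z : Cn) : 'rV[R]_n * 'rV[R]_n :=
  (map_mx (@complex.Re R) z, map_mx (@complex.Im R) z).

Definition domain (Omega : set Cn) : Prop :=
  [/\ Omega !=set0, open Omega & connected Omega].

Definition boundary (Omega : set Cn) : set Cn := closure Omega `\` Omega°.

(* The real gradient of [rho] at [z] as a vector of C^n: the j-th coordinate is
   d rho/d x_j + i d rho/d y_j. *)
Definition gradient (rho : 'rV[R]_n * 'rV[R]_n -> R) (z : Cn) : Cn :=
  \row_j ('d rho (ReIm z) (delta_mx 0 j, 0) +i*
          'd rho (ReIm z) (0, delta_mx 0 j)).

Definition local_defining_function (Omega : set Cn) (p : Cn) (U : set Cn)
    (rho : 'rV[R]_n * 'rV[R]_n -> R) : Prop :=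
  [/\ open U, U p &
    forall z, U z ->
      [/\ differentiable rho (ReIm z),
          forall v, {for ReIm z, continuous ('D_v rho)},
          gradient rho z != 0 &
          Omega z <-> rho (ReIm z) < 0]].

Definition C1_boundary (Omega : set Cn) : Prop :=
  forall p, boundary Omega p ->
    exists U rho, local_defining_function Omega p U rho.

(* At a boundary point p, the gradients at p of two local defining functions
   are positive multiples of each other, so that the next two definitions do
   not depend on the choice of [rho]. *)
Definition unit_outward_normal (Omega : set Cn) (p N : Cn) : Prop :=
  exists U rho, local_defining_function Omega p U rho /\
    N = ((enorm (gradient rho p))^-1)%:C *: gradient rho p.

Definition real_tangent_space (Omega : set Cn) (p : Cn) : set Cn :=
  [set v | exists U rho, local_defining_function Omega p U rho /\
    'd rho (ReIm p) (ReIm v) = 0].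

(* The largest complex subspace contained in the real tangent space. *)
Definition complex_tangent_space (Omega : set Cn) (p : Cn) : set Cn :=
  [set v | forall a : R[i], real_tangent_space Omega p (a *: v)].

Definition unit_complex_tangential (Omega : set Cn) (p L : Cn) : Prop :=
  enorm L = 1 /\ complex_tangent_space Omega p L.

Definition holomorphic_on (Omega : set Cn) (f : Cn -> R[i]) : Prop :=
  forall z, Omega z -> differentiable f z.

Definition lipschitz_of_order (alpha : R) (Omega : set Cn) (f : Cn -> R[i])
    : Prop :=
  exists K : R, forall z w, Omega z -> Omega w ->
    normc (f z - f w) <= K * enorm (z - w) `^ alpha.

Definition bidisc (k : nat) (c1 c2 delta : R) : set (R[i] * R[i]) :=
  [set w | normc w.1 <= c1 * delta /\ normc w.2 <= c2 * delta `^ k%:R^-1].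

(* [N] is meant to be the unit outward normal at [p] and [L] a unit complex
   tangential vector at [p]. *)
Definition disc_property (k : nat) (Omega : set Cn) (p N L : Cn) : Prop :=
  exists delta_p c1 c2 : R, [/\ 0 < delta_p, 0 < c1, 0 < c2 &
    forall delta : R, 0 < delta <= delta_p ->
      [set (p - delta%:C *: N) - w.1 *: N + w.2 *: L
         | w in bidisc k c1 c2 delta] `<=` Omega].

End ComplexSpace.

(* Main.v *)
Require Import Defs.
From mathcomp Require Import ring lra.

(** Write Q_d = p - d N and let D(h, d) = f(Q_d + h L) - f(Q_d) be the increment
to be bounded. The function
[w |-> f(Q_d + w L) - f(Q_2d + w L)] is holomorphic on the disc
|w| < c d^(1/k) provided by the disc property, and it is O(d^alpha) there, because
its two arguments differ by d N only. Schwarz's lemma bounds its increment between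
0 and h, and that increment is D(h, d) - D(h, 2d); hence
|D(h, d) - D(h, 2d)| <= A d^(alpha - 1/k) |h|  ([increment_doubling]).
Since alpha < 1/k, these errors decrease geometrically along d, 2d, 4d, ..., and
for d bounded away from 0 Schwarz's lemma on a single disc gives
D(h, d) = O(|h|). Summing up, |D(h, d)| <= B d^(alpha - 1/k) |h|
([increment_bound]). Finally |h| <= c d^(1/k) means that d is at least
(|h| / c)^k, so the negative power of d is at most a constant times
|h|^(k alpha - 1) ([scale_comparison]).

Schwarz's lemma is needed, up to a constant, for functions that are only assumed
to be complex differentiable at every point. It rests on the estimate
|phi'(0)| <= 2 M / r for |phi - phi(0)| <= M on the disc of radius r, and on the
mean value inequality. The estimate is Goursat's argument, in logarithmic
coordinates and without integrals. The function
F(zeta) = (phi(exp zeta) - phi(0)) exp(- zeta) is holomorphic and 2 pi i-periodic,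
tends to phi'(0) as Re zeta -> -oo, and is bounded by 2 M / r on the line
Re zeta = ln (r / 2). Its midpoint sums over the boundary of a rectangle of height
2 pi tend to 0 as the mesh does ([discrete_goursat]); the horizontal sides cancel
by periodicity, so that the two vertical sides are nearly equal: the left one is
close to 2 pi i phi'(0), the right one at most 2 pi (2 M / r).

Both Goursat's theorem and the mean value inequality pass from infinitesimal to
full size through a single compactness principle: a property that is inherited
from four quarters and holds for all small parallelograms around each point holds
globally ([bisection]). *)

Set Implicit Arguments.
Unset Strict Implicit.
Unset Printing Implicit Defensive.

Local Open Scope classical_set_scope.
Local Open Scope complex_scope.
Local Open Scope ring_scope.

(** * Bisection of parallelograms *)

Lemma dyadic_point (R : realType) (a : R^nat) :
  (forall j, a j <= a j.+1 <= a j + 2 ^- j.+1) ->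
  exists x, forall j, a j <= x <= a j + 2 ^- j.
Proof.
move=> ha; pose b j := a j + 2 ^- j.
have halfS j : (2 : R) ^- j = 2 ^- j.+1 + 2 ^- j.+1.
  by rewrite exprS invfM; field; rewrite expf_neq0 ?pnatr_eq0.
have a_incr m j : a m <= a (m + j)%N.
  by elim: j => [|j IH]; rewrite ?addn0// addnS; case/andP: (ha (m + j)%N); lra.
have b_decr m j : b (m + j)%N <= b m.
  elim: j => [|j IH]; rewrite ?addn0// addnS; case/andP: (ha (m + j)%N).
  by move: IH; rewrite /b (halfS (m + j)%N); lra.
have a_le_b m j : a m <= b j.
  have a_le c : a c <= b c by rewrite /b lerDl invr_ge0 exprn_ge0.
  case: (leqP m j) => [/subnKC <-|/ltnW/subnKC <-].
    exact: le_trans (a_incr _ _) (a_le _).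
  exact: le_trans (a_le _) (b_decr _ _).
exists (sup (range a)) => j; apply/andP; split.
  by apply: ub_le_sup; [exists (b 0%N) => _ [m _ <-]|exists j].
apply: ge_sup; [by exists (a 0%N); exists 0%N|move=> _ [m _ <-]]; exact: a_le_b.
Qed.

(** Cousin's lemma. Were P to fail, it would fail on one of the quarters, and on a
quarter of that one, and so on; these nested parallelograms shrink to a point,
where the local hypothesis contradicts the failure. The local hypothesis concerns
only parallelograms that contain the point: this is what a pointwise derivative can
control, and what a Lebesgue number of a cover would not give. *)
Lemma bisection (R : realType) (P : R[i] -> R[i] -> R[i] -> Prop) z d e :
  (forall z d e, P z (d / 2) (e / 2) -> P (z + d / 2) (d / 2) (e / 2) ->
     P (z + e / 2) (d / 2) (e / 2) -> P (z + d / 2 + e / 2) (d / 2) (e / 2) ->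
     P z d e) ->
  (forall x y : R, 0 <= x <= 1 -> 0 <= y <= 1 ->
     exists2 r : R, 0 < r & forall t u v : R, 0 < t < r ->
       u <= x <= u + t -> v <= y <= v + t ->
       P (z + u%:C * d + v%:C * e) (t%:C * d) (t%:C * e)) ->
  P z d e.
Proof.
move=> glue loc; apply: contrapT => nP.
pose t j : R := 2 ^- j.
have tS j : t j = t j.+1 * 2 by rewrite /t exprS invfM mulrAC mulVf ?mul1r// pnatr_eq0.
have t_gt0 j : 0 < t j by rewrite invr_gt0 exprn_gt0.
(* The state s locates the corner of the j-th parallelogram, in units of d and e. *)
pose B j (s : R * R) := ~ P (z + s.1%:C * d + s.2%:C * e) ((t j)%:C * d) ((t j)%:C * e).
have step (js : nat * (R * R)) : exists s' : R * R, B js.1 js.2 ->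
    [/\ B js.1.+1 s', js.2.1 <= s'.1 <= js.2.1 + t js.1.+1
      & js.2.2 <= s'.2 <= js.2.2 + t js.1.+1].
  case: js => j [x y] /=; apply: contrapT => nex; apply: nex.
  have [Bj|nBj] := pselect (B j (x, y)); last by exists (0, 0).
  apply: contrapT => nex.
  have Q (b c : bool) : P (z + (x + b%:R * t j.+1)%:C * d + (y + c%:R * t j.+1)%:C * e)
      ((t j.+1)%:C * d) ((t j.+1)%:C * e).
    apply: contrapT => nQ; apply: nex.
    exists (x + b%:R * t j.+1, y + c%:R * t j.+1) => _; split => //=.
      by case: b {nQ} => /=; move: (t_gt0 j.+1); lra.
    by case: c {nQ} => /=; move: (t_gt0 j.+1); lra.
  have half a : (t j)%:C * a / 2 = (t j.+1)%:C * a.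
    by rewrite tS rmorphM rmorph_nat; field.
  apply: Bj => /=; apply: glue; rewrite !half.
  - by have := Q false false; rewrite !mul0r !addr0.
  - have := Q true false; rewrite !mul0r !mul1r !addr0; congr (P _ _ _).
    by rewrite rmorphD; ring.
  - have := Q false true; rewrite !mul0r !mul1r !addr0; congr (P _ _ _).
    by rewrite rmorphD; ring.
  - have := Q true true; rewrite !mul1r; congr (P _ _ _).
    by rewrite !rmorphD; ring.
have [next nextP] := choice step.
pose s := fix s j := if j is j'.+1 then next (j', s j') else (0, 0).
have sB j : B j (s j).
  elim: j => [|j IH]; last by have [] := nextP (j, s j) IH.
  by rewrite /B /t /= expr0 invr1 !mul0r !mul1r !addr0.
have sP j : (s j).1 <= (s j.+1).1 <= (s j).1 + t j.+1 /\
            (s j).2 <= (s j.+1).2 <= (s j).2 + t j.+1.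
  by have [] := nextP (j, s j) (sB j).
have [x hx] := dyadic_point (fun j => proj1 (sP j)).
have [y hy] := dyadic_point (fun j => proj2 (sP j)).
have [r r0 hr] : exists2 r : R, 0 < r & forall t u v : R, 0 < t < r ->
       u <= x <= u + t -> v <= y <= v + t ->
       P (z + u%:C * d + v%:C * e) (t%:C * d) (t%:C * e).
  apply: loc; [have := hx 0%N | have := hy 0%N];
  by rewrite /= expr0 invr1 add0r.
have [m tm] : exists m, t m < r.
  have := @cvg_geometric _ (1 : R) 2^-1; rewrite ger0_norm ?invr_ge0// => /(_ ltac:(lra)).
  move=> /cvgrPdist_lt /(_ _ r0)[m _ /(_ m (leqnn m))].
  rewrite /geometric/= sub0r normrN mul1r exprVn ger0_norm ?(ltW (t_gt0 m))// => ?.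
  by exists m.
by apply: (sB m); apply: hr => //; rewrite t_gt0.
Qed.

(** * The modulus of a complex number *)

Section Modulus.
Context {R : realType}.
Implicit Types x y z : R[i].

Lemma normc_ge0 z : 0 <= normc z.
Proof. by case: z => a b; rewrite sqrtr_ge0. Qed.

Lemma normcD_le x y : normc (x + y) <= normc x + normc y.
Proof. exact: (le_normcD (x : Rcomplex R) y). Qed.

Lemma normcB_le x y : normc (x - y) <= normc x + normc y.
Proof. by rewrite -[normc y](normcN (y : Rcomplex R)); exact: normcD_le. Qed.

Lemma normc_sub x y : normc (x - y) = normc (y - x).
Proof. by rewrite -[RHS](normcN (y - x : Rcomplex R)) opprB. Qed.

Lemma normc_real (a : R) : normc a%:C = `|a|.
Proof. by rewrite /normc /= expr0n addr0 sqrtr_sqr. Qed.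

Lemma normc_i : normc ('i : R[i]) = 1.
Proof. by rewrite /normc /= expr0n add0r expr1n sqrtr1. Qed.

Lemma realC_half (a : R) : (a / 2)%:C = a%:C / 2 :> R[i].
Proof. by rewrite rmorphM fmorphV rmorph_nat. Qed.

Lemma normc_half z : normc (z / 2) = normc z / 2.
Proof. by rewrite normcM normcV -[2]/(2%:R) -(rmorph_nat (real_complex R)) normc_real ger0_norm. Qed.

End Modulus.

(** * Goursat's theorem for midpoint sums *)

Section Goursat.
Context {R : realType}.
Implicit Types (F : R[i] -> R[i]) (z d e : R[i]).

(** Moduli and errors are taken in R rather than in R[i], whose order is partial,
so that inequalities can be combined by real arithmetic. *)
Definition has_cderiv F z (A : R[i]) := forall eta : R, 0 < eta ->
  exists2 r : R, 0 < r & forall w, normc (w - z) < r ->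
    normc (F w - F z - A * (w - z)) <= eta * normc (w - z).

(** The midpoint Riemann sum, with 2^m pieces, of F over the segment from z to
z + d. Halving the segment in the recursion makes the sums additive under bisection
by definition. *)
Fixpoint segsum F m z d : R[i] :=
  if m is m'.+1 then segsum F m' z (d / 2) + segsum F m' (z + d / 2) (d / 2)
  else d * F (z + d / 2).

Definition contour F m z d e : R[i] :=
  segsum F m z d + segsum F m (z + d) e - segsum F m (z + e) d - segsum F m z e.

(** The sums over the sides common to two quarters cancel. *)
Lemma contourS F m z d e : contour F m.+1 z d e =
  contour F m z (d / 2) (e / 2) + contour F m (z + d / 2) (d / 2) (e / 2) +
  contour F m (z + e / 2) (d / 2) (e / 2) +
  contour F m (z + d / 2 + e / 2) (d / 2) (e / 2).
Proof.
rewrite /contour /=.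
have -> : z + d / 2 + d / 2 = z + d by field.
have -> : z + e / 2 + e / 2 = z + e by field.
have -> : z + d / 2 + e / 2 + d / 2 = z + d + e / 2 by field.
have -> : z + d / 2 + e / 2 + e / 2 = z + e + d / 2 by field.
have -> : z + e / 2 + d / 2 = z + d / 2 + e / 2 by field.
ring.
Qed.

(** The midpoint rule is exact on affine functions, at every mesh; so contour sums
of affine functions vanish exactly. *)
Lemma segsum_affine A B m z d :
  segsum (fun w => A + B * w) m z d = d * (A + B * (z + d / 2)).
Proof. by elim: m z d => [|m IH] z d //=; rewrite !IH; field. Qed.

Lemma segsumB F G m z d :
  segsum (fun w => F w - G w) m z d = segsum F m z d - segsum G m z d.
Proof. by elim: m z d => [|m IH] z d /=; rewrite ?IH; ring. Qed.

Lemma segsum_le F m z d (b : R) :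
  (forall t : R, 0 <= t <= 1 -> normc (F (z + t%:C * d)) <= b) ->
  normc (segsum F m z d) <= normc d * b.
Proof.
have halfC (t : R) a : t%:C * (a / 2) = (t / 2)%:C * a.
  by rewrite realC_half; field.
elim: m z d => [|m IH] z d hF /=.
  have -> : z + d / 2 = z + (2^-1 : R)%:C * d.
    by rewrite fmorphV rmorph_nat mulrC.
  by rewrite normcM ler_wpM2l ?normc_ge0// hF//; apply/andP; split; lra.
apply: le_trans (normcD_le _ _) _.
have -> : normc d * b = normc (d / 2) * b + normc (d / 2) * b.
  by rewrite normc_half; field.
apply: lerD; apply: IH => t t01; rewrite halfC.
  by apply: hF; apply/andP; split; lra.
have -> : z + d / 2 + (t / 2)%:C * d = z + ((1 + t) / 2)%:C * d.
  by rewrite !realC_half rmorphD rmorph1; field.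
by apply: hF; apply/andP; split; lra.
Qed.

Lemma contour_near_affine F m z d e A B (b : R) :
  (forall u v : R, 0 <= u <= 1 -> 0 <= v <= 1 ->
    let w := z + u%:C * d + v%:C * e in normc (F w - (A + B * w)) <= b) ->
  normc (contour F m z d e) <= 2 * (normc d + normc e) * b.
Proof.
move=> hF; pose G w := F w - (A + B * w).
have -> : contour F m z d e = contour G m z d e.
  by rewrite /contour !segsumB !segsum_affine; field.
have h01 : (0 : R) <= (0 : R) <= (1 : R) by apply/andP; split; lra.
have h11 : (0 : R) <= (1 : R) <= (1 : R) by apply/andP; split; lra.
have -> : 2 * (normc d + normc e) * b =
  normc d * b + normc e * b + normc d * b + normc e * b by ring.
rewrite /contour.
apply: le_trans (normcB_le _ _) _; apply: lerD; last first.
  apply: segsum_le => t t01; have := hF 0 t h01 t01.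
  by rewrite mul0r addr0.
apply: le_trans (normcB_le _ _) _; apply: lerD; last first.
  apply: segsum_le => t t01; have := hF t 1 t01 h11.
  by rewrite mul1r addrAC.
apply: le_trans (normcD_le _ _) _; apply: lerD.
  apply: segsum_le => t t01; have := hF t 0 t01 h01.
  by rewrite mul0r addr0.
apply: segsum_le => t t01; have := hF 1 t h11 t01.
by rewrite mul1r.
Qed.

(** On a small parallelogram around a point of differentiability F is affine up to
o(diameter), so the contour sum is o(area), at every mesh. The bound proportional to
the square of the perimeter is additive over quarters, and [bisection] propagates
it. *)
Lemma discrete_goursat F z d e (eta : R) : 0 < eta ->
  (forall u v : R, 0 <= u <= 1 -> 0 <= v <= 1 ->
    exists A, has_cderiv F (z + u%:C * d + v%:C * e) A) ->
  exists m0, forall m, (m0 <= m)%N -> normc (contour F m z d e) <= eta.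
Proof.
move=> eta0 hF.
(* D normalises the error per unit area; the + 1 covers d = e = 0. *)
pose D := 2 * (normc d + normc e) ^+ 2 + 1.
have D0 : 0 < D by rewrite ltr_wpDl// mulr_ge0// sqr_ge0.
suff [m0 hm0] : exists m0, forall m, (m0 <= m)%N ->
    normc (contour F m z d e) <= eta / D * 2 * (normc d + normc e) ^+ 2.
  exists m0 => m /hm0 /le_trans; apply.
  rewrite -mulrA mulrAC ler_pdivrMr// ler_pM2l// /D; lra.
pose P z d e := exists m0, forall m, (m0 <= m)%N ->
    normc (contour F m z d e) <= eta / D * 2 * (normc d + normc e) ^+ 2.
rewrite -/(P z d e); apply: bisection => [{hF D0}z' d' e'|x y x01 y01].
  move=> [m1 h1] [m2 h2] [m3 h3] [m4 h4].
  (* One level is spent on the bisection itself, by [contourS]. *)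
  exists (maxn (maxn m1 m2) (maxn m3 m4)).+1 => -[//|m].
  rewrite ltnS !geq_max => /andP[/andP[/h1 {}h1 /h2 {}h2] /andP[/h3 {}h3 /h4 {}h4]].
  move: h1 h2 h3 h4; rewrite contourS !normc_half.
  set a1 := contour _ _ _ _ _; set a2 := contour _ _ _ _ _.
  set a3 := contour _ _ _ _ _; set a4 := contour _ _ _ _ _ => h1 h2 h3 h4.
  have := normcD_le (a1 + a2 + a3) a4; have := normcD_le (a1 + a2) a3.
  have := normcD_le a1 a2.
  have : (normc d' / 2 + normc e' / 2) ^+ 2 = (normc d' + normc e') ^+ 2 / 4 by field.
  move=> sqE; rewrite sqE in h1 h2 h3 h4.
  lra.
have [A hA] := hF x y x01 y01.
have [r r0 hr] := hA (eta / D) (divr_gt0 eta0 D0).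
set w0 := (z + x%:C * d + y%:C * e) in hA hr.
exists (r / (normc d + normc e + 1)).
  by rewrite divr_gt0// ltr_wpDl// addr_ge0 ?normc_ge0.
move=> t u v /andP[t0 tr] hu hv; exists 0%N => m _.
have tN a : normc (t%:C * a) = t * normc a by rewrite normcM normc_real gtr0_norm.
have -> : eta / D * 2 * (normc (t%:C * d) + normc (t%:C * e)) ^+ 2 =
  2 * (normc (t%:C * d) + normc (t%:C * e)) * (eta / D * (t * normc d + t * normc e)).
  by rewrite !tN; ring.
apply: (@contour_near_affine _ _ _ _ _ (F w0 - A * w0) A) => a b a01 b01 /=.
set w := (X in F X).
have -> : F w - (F w0 - A * w0 + A * w) = F w - F w0 - A * (w - w0) by ring.
have ww0 : normc (w - w0) <= t * normc d + t * normc e.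
  have -> : w - w0 = (u + a * t - x)%:C * d + (v + b * t - y)%:C * e.
    by rewrite /w /w0 !(rmorphD, rmorphN, rmorphM) /=; ring.
  apply: le_trans (normcD_le _ _) _; rewrite !normcM !normc_real.
  by apply: lerD; apply: ler_wpM2r; rewrite ?normc_ge0// ler_norml;
    apply/andP; split; nra.
apply: le_trans (hr _ _) _; last by rewrite ler_wpM2l// divr_ge0 ?ltW.
apply: le_lt_trans ww0 _; move: tr; rewrite ltr_pdivlMr.
  by move: (normc_ge0 d) (normc_ge0 e); nra.
by rewrite ltr_wpDl// addr_ge0 ?normc_ge0.
Qed.

End Goursat.

(** * Complex derivatives *)

Section ComplexDerivative.
Context {R : realType}.
Implicit Types (F G g phi : R[i] -> R[i]) (z : R[i]).

Lemma has_cderiv_lip F z A : has_cderiv F z A ->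
  exists2 r : R, 0 < r &
    forall w, normc (w - z) < r -> normc (F w - F z) <= (normc A + 1) * normc (w - z).
Proof.
move=> hF; have [r r0 hr] := hF 1 ltr01; exists r => // w /hr.
have -> : F w - F z = (F w - F z - A * (w - z)) + A * (w - z) by ring.
by have := normcD_le (F w - F z - A * (w - z)) (A * (w - z)); rewrite normcM addrK; lra.
Qed.

Lemma has_cderiv_comp phi g z A B : has_cderiv g z B -> has_cderiv phi (g z) A ->
  has_cderiv (phi \o g) z (A * B).
Proof.
move=> hg hphi eta eta0.
have hA := normc_ge0 A; have hB := normc_ge0 B.
have e10 : 0 < eta / (2 * (normc A + 1)) by rewrite divr_gt0// mulr_gt0//; lra.
have e20 : 0 < eta / (2 * (normc B + 1)) by rewrite divr_gt0// mulr_gt0//; lra.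
have [r1 r10 h1] := hg _ e10; have [r2 r20 h2] := hphi _ e20.
have [r3 r30 h3] := has_cderiv_lip hg.
exists (Num.min (Num.min r1 r3) (r2 / (normc B + 1))).
  by rewrite !lt_min r10 r30 divr_gt0//; lra.
move=> w; rewrite !lt_min => /andP[/andP[/h1 {}h1 /h3 {}h3]].
rewrite ltr_pdivlMr ?[0 < _]ltr_wpDl//.
rewrite [normc _ * _]mulrC => wr2; have {}h2 := h2 (g w) (le_lt_trans h3 wr2).
rewrite /=; set x := g w - g z in h1 h2 h3.
have -> : phi (g w) - phi (g z) - A * B * (w - z) =
    (phi (g w) - phi (g z) - A * x) + A * (x - B * (w - z)) by ring.
apply: le_trans (normcD_le _ _) _; rewrite normcM.
have {}h2 := le_trans h2 (ler_wpM2l (ltW e20) h3).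
have {}h1 := ler_wpM2l hA h1.
have E2 : eta / (2 * (normc B + 1)) * ((normc B + 1) * normc (w - z)) =
    eta / 2 * normc (w - z) by field; lra.
have E1 : normc A * (eta / (2 * (normc A + 1)) * normc (w - z)) <=
    eta / 2 * normc (w - z).
  have -> : eta / 2 * normc (w - z) =
    (normc A + 1) * (eta / (2 * (normc A + 1)) * normc (w - z)) by field; lra.
  by apply: ler_wpM2r; [rewrite mulr_ge0 ?normc_ge0// ltW|lra].
lra.
Qed.

Lemma has_cderivM F G z A B : has_cderiv F z A -> has_cderiv G z B ->
  has_cderiv (fun w => F w * G w) z (A * G z + F z * B).
Proof.
move=> hF hG eta eta0.
have hA := normc_ge0 A; have hB := normc_ge0 B.
have hFz := normc_ge0 (F z); have hGz := normc_ge0 (G z).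
pose k := normc (F z) + normc (G z) + (normc A + 1) * (normc B + 1).
have AB0 : 0 < (normc A + 1) * (normc B + 1) by rewrite mulr_gt0//; lra.
have k0 : 0 < k by rewrite /k; lra.
have e0 : 0 < eta / k by rewrite divr_gt0.
have [r1 r10 h1] := hF _ e0; have [r2 r20 h2] := hG _ e0.
have [r3 r30 h3] := has_cderiv_lip hF; have [r4 r40 h4] := has_cderiv_lip hG.
exists (Num.min (Num.min (Num.min r1 r2) (Num.min r3 r4)) (eta / k)).
  by rewrite !lt_min r10 r20 r30 r40.
move=> w; rewrite !lt_min.
move=> /andP[/andP[/andP[/h1{}h1 /h2{}h2] /andP[/h3{}h3 /h4{}h4]] we].
have -> : F w * G w - F z * G z - (A * G z + F z * B) * (w - z) =
    (F w - F z - A * (w - z)) * G z + F z * (G w - G z - B * (w - z)) +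
    (F w - F z) * (G w - G z) by ring.
have -> : eta * normc (w - z) = eta / k * normc (w - z) * normc (G z) +
    normc (F z) * (eta / k * normc (w - z)) +
    (normc A + 1) * (normc B + 1) * (eta / k * normc (w - z)).
  by rewrite /k; field; rewrite -/k lt0r_neq0.
have N0 := normc_ge0 (w - z).
apply: le_trans (normcD_le _ _) _; apply: lerD.
  apply: le_trans (normcD_le _ _) _; rewrite !normcM; apply: lerD.
    exact: ler_wpM2r.
  exact: ler_wpM2l.
rewrite normcM; apply: le_trans (ler_pM (normc_ge0 _) (normc_ge0 _) h3 h4) _.
rewrite mulrACA; apply: ler_wpM2l; first exact: ltW.
by apply: ler_wpM2r => //; exact: ltW.
Qed.

Lemma has_cderivBr F c z A : has_cderiv F z A -> has_cderiv (fun w => F w - c) z A.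
Proof.
move=> hF eta /hF[r r0 hr]; exists r => // w.
have -> : F w - c - (F z - c) = F w - F z by ring.
exact: hr.
Qed.

Lemma has_cderivB F G z A B : has_cderiv F z A -> has_cderiv G z B ->
  has_cderiv (fun w => F w - G w) z (A - B).
Proof.
move=> hF hG eta eta0.
have [r1 r10 h1] := hF (eta / 2) ltac:(lra).
have [r2 r20 h2] := hG (eta / 2) ltac:(lra).
exists (Num.min r1 r2); rewrite ?lt_min ?r10// => w.
rewrite lt_min => /andP[/h1{}h1 /h2{}h2].
have -> : F w - G w - (F z - G z) - (A - B) * (w - z) =
  (F w - F z - A * (w - z)) - (G w - G z - B * (w - z)) by ring.
by apply: le_trans (normcB_le _ _) _; lra.
Qed.

Lemma has_cderiv_affine (a b z : R[i]) : has_cderiv (fun w => a + b * w) z b.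
Proof.
move=> eta eta0; exists 1 => // w _.
have -> : a + b * w - (a + b * z) - b * (w - z) = 0 by ring.
by rewrite normc0 mulr_ge0 ?normc_ge0// ltW.
Qed.

End ComplexDerivative.

Lemma differentiable_approx (K : numFieldType) (V W : normedModType K)
    (F : V -> W) (x : V) : differentiable F x ->
  forall eta : K, 0 < eta -> \forall h \near (0 : V),
    `|F (h + x) - F x - 'd F x h| <= eta * `|h|.
Proof.
move=> dF eta eta0.
have [_ /eqaddoP /(_ eta eta0)] := proj1 (diff_locallyP _ _) dF.
by apply: filterS => h /=; rewrite !fctE opprD addrA.
Qed.

(** Stated with the range W of F kept abstract, so that it applies to values in
R[i] with whichever normed module structure F carries. *)
Lemma differentiable_line (K : numFieldType) (V W : normedModType K)
    (F : V -> W) (x v : V) : differentiable F x ->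
  exists A : W, forall eta : K, 0 < eta -> exists2 r : K, 0 < r &
    forall h : K, `|h| < r -> `|F (x + h *: v) - F x - h *: A| <= eta * `|h|.
Proof.
move=> dF; exists ('d F x v) => eta eta0.
have nv0 : 0 < `|v| + 1 by rewrite ltr_wpDl.
have /nbhs_ballP[r r0 hr] := differentiable_approx dF (divr_gt0 eta0 nv0).
exists (r / (`|v| + 1)); first by rewrite divr_gt0.
move=> h; rewrite ltr_pdivlMr// => hh.
have := hr (h *: v); rewrite -ball_normE /= sub0r normrN normrZ.
have hv : `|h| * `|v| <= `|h| * (`|v| + 1) by rewrite ler_wpM2l// lerDl.
move=> /(_ (le_lt_trans hv hh)); rewrite linearZ /= [h *: v + x]addrC => /le_trans; apply.
by rewrite mulrAC ler_pdivrMr// -mulrA ler_wpM2l// ltW.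
Qed.

Section ComplexLine.
Context {R : realType}.

Lemma ltc_real (e : R[i]) : 0 < e -> exists2 r : R, 0 < r & e = r%:C.
Proof.
case: e => a b; rewrite ltcE /= => /andP[/eqP -> a0].
by exists a.
Qed.

Lemma has_cderiv_line n (f : 'rV[R[i]]_n -> R[i]) (Q L : 'rV[R[i]]_n) z :
  differentiable f (Q + z *: L) ->
  exists A, has_cderiv (fun w => f (Q + w *: L)) z A.
Proof.
move=> /differentiable_line-/(_ L)[A hA]; exists A => eta eta0.
have [_ /ltc_real[r r0 ->] hr] := hA eta%:C ltac:(by rewrite ltcR).
exists r => // w wz; have := hr (w - z).
have -> : Q + z *: L + (w - z) *: L = Q + w *: L.
  by rewrite -addrA -scalerDl [z + _]addrC subrK.
rewrite ltcR => /(_ wz); rewrite -rmorphM lecR.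
by rewrite [_ *: A]mulrC.
Qed.

End ComplexLine.

(** * The complex exponential *)

Section ComplexExponential.
Context {R : realType}.
Implicit Types (z w : R[i]).

Definition cexp z : R[i] :=
  (expR (complex.Re z))%:C * (cos (complex.Im z) +i* sin (complex.Im z)).

Lemma cexpD z w : cexp (z + w) = cexp z * cexp w.
Proof.
case: z w => [a b] [c d]; rewrite /cexp /= expRD cosD sinD.
by apply/eqP; rewrite eq_complex /=; apply/andP; split; apply/eqP; ring.
Qed.

Lemma cexp_real (x : R) : cexp x%:C = (expR x)%:C.
Proof.
rewrite /cexp /= cos0 sin0.
by apply/eqP; rewrite eq_complex /=; apply/andP; split; apply/eqP; ring.
Qed.

Lemma cexp_period : cexp ((2 * pi)%:C * 'i) = 1.
Proof.
rewrite /cexp /= !(mul0r, mulr0, mulr1, subr0, addr0) expR0 mul1r.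
by rewrite mulr_natl cos2pi sin2pi.
Qed.

Lemma normc_cexp z : normc (cexp z) = expR (complex.Re z).
Proof.
rewrite normcM normc_real ger0_norm ?expR_ge0// /normc /= cos2Dsin2 sqrtr1.
by rewrite mulr1.
Qed.

Lemma normc_cexpN z : normc (cexp (- z)) = (normc (cexp z))^-1.
Proof. by rewrite !normc_cexp raddfN expRN. Qed.

Lemma normc_ge_ReIm z : `|complex.Re z| <= normc z /\ `|complex.Im z| <= normc z.
Proof.
case: z => a b /=; rewrite -!sqrtr_sqr.
by split; apply: ler_wsqrtr; rewrite ?lerDl ?lerDr sqr_ge0.
Qed.

Lemma normc_le_ReIm z : normc z <= `|complex.Re z| + `|complex.Im z|.
Proof.
case: z => a b /=; rewrite -(@ger0_norm _ (`|a| + `|b|)) ?addr_ge0//.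
rewrite -sqrtr_sqr; apply: ler_wsqrtr; rewrite sqrrD !real_normK ?num_real//.
by rewrite lerD2r lerDl mulrn_wge0// mulr_ge0.
Qed.

Lemma is_derive_approx (g : R -> R) (x dg : R) : is_derive x 1 g dg ->
  forall eta : R, 0 < eta -> exists2 r : R, 0 < r &
    forall h, `|h| < r -> `|g (h + x) - g x - dg * h| <= eta * `|h|.
Proof.
move=> [dg1 dgE] eta eta0.
have /derivable1_diffP dg' := dg1.
have /nbhs_ballP[r r0 hr] := differentiable_approx dg' eta0.
exists r => // h hh; have := hr h; rewrite /ball /= sub0r normrN => /(_ hh).
by rewrite diff1E// [_ *: _]mulrC derive1E dgE.
Qed.

Lemma has_cderiv_cexp0 : has_cderiv cexp (0 : R[i]) 1.
Proof.
move=> eta eta0.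
(* With |x|, |y| <= N < e <= 1/9, splitting off one factor at a time as below
   leaves an error of at most 7 e N. *)
pose e := Num.min eta 1 / 9.
have e0 : 0 < e by rewrite divr_gt0// lt_min eta0 ltr01.
have e9 : 9 * e <= eta by rewrite /e mulrC divfK ?pnatr_eq0// ge_min lexx.
have e1 : e <= 1 / 9 by rewrite ler_pM2r ?invr_gt0// ge_min lexx orbT.
have [r1 r10 h1] := is_derive_approx (is_derive_expR (0 : R)) e0.
have [r2 r20 h2] := is_derive_approx (is_derive_cos (0 : R)) e0.
have [r3 r30 h3] := is_derive_approx (is_derive_sin (0 : R)) e0.
exists (Num.min (Num.min r1 r2) (Num.min r3 e)).
  by rewrite !lt_min r10 r20 r30.
move=> w; rewrite subr0 !lt_min => /andP[/andP[w1 w2] /andP[w3 we]].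
have [wx wy] := normc_ge_ReIm w.
have := h1 _ (le_lt_trans wx w1); have := h2 _ (le_lt_trans wy w2).
have := h3 _ (le_lt_trans wy w3).
rewrite !addr0 expR0 cos0 sin0 oppr0 mul0r mul1r !subr0 mul1r addr0.
rewrite cexp_real expR0 mul1r => hs hc hE.
apply: le_trans (normc_le_ReIm _) _.
have [-> ->] : complex.Re (cexp w - 1 - w) =
      expR (complex.Re w) * cos (complex.Im w) - 1 - complex.Re w /\
    complex.Im (cexp w - 1 - w) =
      expR (complex.Re w) * sin (complex.Im w) - complex.Im w.
  by case: (w) => x y; rewrite /cexp /=; split; ring.
move: (complex.Re w) (complex.Im w) (normc w) wx wy we hs hc hE => x y N wx wy we hs hc hE.
move: (expR x) (cos y) (sin y) hs hc hE => E c s hs hc hE.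
have N0 : 0 <= N := le_trans (normr_ge0 _) wx.
have E1 : `|E - 1| <= 2 * N.
  have -> : E - 1 = (E - 1 - x) + x by ring.
  by apply: le_trans (ler_normD _ _) _; nra.
have E2 : `|E| <= 2.
  have -> : E = (E - 1) + 1 by ring.
  by apply: le_trans (ler_normD _ _) _; rewrite normr1; lra.
have -> : E * c - 1 - x = E * (c - 1) + (E - 1 - x) by ring.
have -> : E * s - y = E * (s - y) + (E - 1) * y by ring.
apply: (@le_trans _ _ (2 * (e * N) + e * N + (2 * (e * N) + 2 * N * N))); last by nra.
have eN (a : R) : `|a| <= N -> e * `|a| <= e * N by rewrite ler_pM2l.
apply: lerD; apply: le_trans (ler_normD _ _) _; rewrite ?normrM; apply: lerD.
- by apply: ler_pM => //; apply: le_trans hc (eN _ wy).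
- exact: le_trans hE (eN _ wx).
- by apply: ler_pM => //; apply: le_trans hs (eN _ wy).
- exact: ler_pM.
Qed.

Lemma has_cderiv_cexp z : has_cderiv cexp z (cexp z).
Proof.
move=> eta eta0.
have cz0 : 0 < normc (cexp z) by rewrite normc_cexp expR_gt0.
have [r r0 hr] := has_cderiv_cexp0 (divr_gt0 eta0 cz0).
exists r => // w wr; have := hr (w - z); rewrite !subr0 => /(_ wr) hw.
have -> : cexp w - cexp z - cexp z * (w - z) =
    cexp z * (cexp (w - z) - cexp 0 - 1 * (w - z)).
  rewrite -{1}(subrK z w) cexpD.
  have -> : cexp (0 : R[i]) = 1 by rewrite cexp_real expR0.
  ring.
rewrite normcM mulrC -ler_pdivlMr//.
by apply: le_trans hw _; rewrite mulrAC.
Qed.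

End ComplexExponential.

(** * Cauchy's estimate and Schwarz's lemma *)

Section SchwarzLemma.
Context {R : realType}.
Implicit Types (F phi : R[i] -> R[i]) (z d e : R[i]).

Lemma segsum_periodic F m z d e : (forall w, F (w + e) = F w) ->
  segsum F m (z + e) d = segsum F m z d.
Proof.
move=> Fe; elim: m z d => [|m IH] z d /=; first by rewrite addrAC Fe.
by rewrite IH addrAC IH.
Qed.

(** In the coordinate w = exp zeta the rectangle with sides from ln q to ln (r / 2)
and from 0 to 2 pi i covers an annulus. By periodicity [discrete_goursat] makes the
sums over the inner and the outer circle nearly equal. The inner one is close to
2 pi i A once q is small, and the outer one is at most 2 pi (2 M / r). *)
Lemma cauchy_estimate phi (r M : R) (A : R[i]) : 0 < r ->
  (forall w, normc w < r -> exists B, has_cderiv phi w B) ->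
  (forall w, normc w < r -> normc (phi w - phi 0) <= M) ->
  has_cderiv phi 0 A -> normc A <= 2 * M / r.
Proof.
move=> r0 dphi phiM hA; apply/ler_addgt0Pl => eps eps0.
have [eta0 pi0] : 0 < eps / 2 /\ 0 < 2 * pi :> R.
  by rewrite divr_gt0// mulr_gt0// pi_gt0.
have [rho rho0 hrho] := hA (eps / 2) eta0.
pose F w := (phi (cexp w) - phi 0) * cexp (- w).
pose q := Num.min rho r / 2.
have q0 : 0 < q by rewrite divr_gt0// lt_min rho0.
have [qrho qr] : q < rho /\ q < r.
  have : q * 2 <= rho /\ q * 2 <= r by rewrite divfK ?pnatr_eq0// !ge_min !lexx orbT.
  lra.
pose z : R[i] := (ln q)%:C.
pose d : R[i] := (ln (r / 2) - ln q)%:C.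
pose e : R[i] := (2 * pi)%:C * 'i.
have r20 : 0 < r / 2 by lra.
have ne : normc e = 2 * pi by rewrite normcM normc_real normc_i mulr1 gtr0_norm.
have cexpV (w : R[i]) : cexp w * cexp (- w) = 1 by rewrite -cexpD subrr cexp_real expR0.
have Fe w : F (w + e) = F w.
  rewrite /F opprD !cexpD cexp_period mulr1.
  suff -> : cexp (- e) = 1 by rewrite mulr1.
  by rewrite -[LHS]mul1r -{1}cexp_period cexpV.
have dF w : normc (cexp w) < r -> exists B, has_cderiv F w B.
  move=> /dphi[B hB]; have hN := has_cderiv_affine 0 (-1) w.
  have {hB}hB := has_cderivBr (phi 0) (has_cderiv_comp (has_cderiv_cexp w) hB).
  have {hN}hN := has_cderiv_comp hN (has_cderiv_cexp _).
  have -> : F = fun v => ((phi \o cexp) v - phi 0) * (cexp \o (fun w => 0 + -1 * w)) v.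
    by apply/funext => v; rewrite /F /= add0r mulN1r.
  by eexists; exact: has_cderivM hB hN.
have [m hm] : exists m0, forall m, (m0 <= m)%N ->
    normc (contour F m z d e) <= 2 * pi * (eps / 2).
  apply: discrete_goursat => [|u v /andP[u0 u1] v01]; first exact: mulr_gt0.
  apply: dF; rewrite normc_cexp.
  have -> : complex.Re (z + u%:C * d + v%:C * e) = (1 - u) * ln q + u * ln (r / 2).
    by rewrite /z /d /e /=; ring.
  have lnq : ln q < ln r by rewrite ltr_ln.
  have lnr : ln (r / 2) < ln r by rewrite ltr_ln//; lra.
  rewrite -[ltRHS](lnK r0) ltr_expR.
  have [mx [hq hr2 mr]] : exists mx, [/\ ln q <= mx, ln (r / 2) <= mx & mx < ln r].
    exists (Num.max (ln q) (ln (r / 2))).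
    by rewrite !le_max !lexx orbT gt_max lnq lnr.
  by apply: le_lt_trans mr; nra.
have {hm} := hm m (leqnn m).
rewrite /contour (segsum_periodic m z d Fe).
set S0 := segsum F m z e; set S1 := segsum F m (z + d) e; set Sd := segsum F m z d => hm.
have hS1 : normc S1 <= 2 * pi * (2 * M / r).
  rewrite -ne; apply: segsum_le => t _.
  have nw : normc (cexp (z + d + t%:C * e)) = r / 2.
    rewrite normc_cexp; have -> : complex.Re (z + d + t%:C * e) = ln (r / 2).
      by rewrite /z /d /e /=; ring.
    by rewrite lnK.
  rewrite /F normcM normc_cexpN nw.
  have -> : 2 * M / r = M * (r / 2)^-1 by field; rewrite lt0r_neq0.
  by apply: ler_wpM2r; [rewrite invr_ge0 ltW|apply: phiM; rewrite nw; lra].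
have hS0 : normc (S0 - e * A) <= 2 * pi * (eps / 2).
  have -> : e * A = segsum (fun w => A + 0 * w) m z e.
    by rewrite segsum_affine mul0r addr0.
  rewrite -segsumB -ne; apply: segsum_le => t _.
  have nw : normc (cexp (z + t%:C * e)) = q.
    rewrite normc_cexp; have -> : complex.Re (z + t%:C * e) = ln q.
      by rewrite /z /e /=; ring.
    by rewrite lnK.
  set w := z + t%:C * e in nw *.
  have -> : F w - (A + 0 * w) = (phi (cexp w) - phi 0 - A * (cexp w - 0)) * cexp (- w).
    by rewrite -[A in LHS]mulr1 -(cexpV w) /F; ring.
  rewrite normcM normc_cexpN nw ler_pdivrMr// -nw -[cexp w in leRHS]subr0.
  by apply: hrho; rewrite subr0 nw.
have : normc (e * A) <= 2 * pi * (2 * M / r + eps).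
  have -> : e * A = S1 - (Sd + S1 - Sd - S0) - (S0 - e * A) by ring.
  have := normcB_le (S1 - (Sd + S1 - Sd - S0)) (S0 - e * A).
  have := normcB_le S1 (Sd + S1 - Sd - S0).
  lra.
rewrite normcM ne.
by rewrite ler_pM2l// addrC.
Qed.

(** An instance of [bisection] on degenerate parallelograms, with e = 0: the
derivative bounds the increment over small segments around each point, and the
bounds add up. *)
Lemma mean_value phi z d (B : R) :
  (forall u : R, 0 <= u <= 1 ->
    exists2 A, has_cderiv phi (z + u%:C * d) A & normc A <= B) ->
  normc (phi (z + d) - phi z) <= B * normc d.
Proof.
move=> hphi; apply/ler_addgt0Pl => eps eps0.
pose eta := eps / (2 * (normc d + 1)).
have d1 : 0 < 2 * (normc d + 1) by rewrite mulr_gt0// ltr_wpDl// normc_ge0.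
have eta0 : 0 < eta by rewrite divr_gt0.
suff : normc (phi (z + d) - phi z) <= (B + 2 * eta) * normc d.
  move=> /le_trans; apply; rewrite mulrDl addrC lerD2r.
  rewrite -[leRHS](divfK (lt0r_neq0 d1)) -/eta.
  by move: (normc_ge0 d); nra.
pose P z d e := e = 0 -> normc (phi (z + d) - phi z) <= (B + 2 * eta) * normc d.
suff : P z d 0 by apply.
apply: (@bisection R P) => [a b c h1 h2 _ _ c0|x y x01 _].
  have c20 : c / 2 = 0 by rewrite c0 mul0r.
  have := h1 c20; have := h2 c20; rewrite normc_half.
  have -> : a + b / 2 + b / 2 = a + b by field.
  have -> : phi (a + b) - phi a =
    (phi (a + b) - phi (a + b / 2)) + (phi (a + b / 2) - phi a) by ring.
  by move=> h3 h4; apply: le_trans (normcD_le _ _) _; lra.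
have [A hA AB] := hphi x x01; have [r r0 hr] := hA _ eta0.
exists (r / (normc d + 1)); first by rewrite divr_gt0// ltr_wpDl// normc_ge0.
move=> t u v /andP[t0 tr] /andP[ux xu] _ _; rewrite mulr0 addr0.
set c := z + x%:C * d in hA hr; set a := z + u%:C * d; set b := a + t%:C * d.
have td : t * normc d < r.
  move: tr; rewrite ltr_pdivlMr; first by move: (normc_ge0 d); nra.
  by rewrite ltr_wpDl// normc_ge0.
have near_c w (s : R) : w - c = s%:C * d -> `|s| <= t ->
    normc (phi w - phi c - A * (w - c)) <= eta * (t * normc d).
  move=> wc st; have wct : normc (w - c) <= t * normc d.
    by rewrite wc normcM normc_real ler_wpM2r// normc_ge0.
  apply: le_trans (hr _ (le_lt_trans wct td)) _.
  by rewrite ler_wpM2l// ltW.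
have ha : normc (phi a - phi c - A * (a - c)) <= eta * (t * normc d).
  apply: (near_c _ (u - x)); first by rewrite /a /c rmorphB; ring.
  by rewrite ler_norml; apply/andP; split; lra.
have hb : normc (phi b - phi c - A * (b - c)) <= eta * (t * normc d).
  apply: (near_c _ (u + t - x)); first by rewrite /b /a /c rmorphB rmorphD; ring.
  by rewrite ler_norml; apply/andP; split; lra.
have -> : phi b - phi a = (phi b - phi c - A * (b - c)) -
    (phi a - phi c - A * (a - c)) + A * (t%:C * d) by rewrite /b; ring.
apply: le_trans (normcD_le _ _) _.
have := normcB_le (phi b - phi c - A * (b - c)) (phi a - phi c - A * (a - c)).
have : normc (A * (t%:C * d)) <= B * (t * normc d).
  rewrite !normcM normc_real gtr0_norm//.
  by apply: ler_wpM2r => //; apply: mulr_ge0; [exact: ltW|exact: normc_ge0].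
have -> : normc (t%:C * d) = t * normc d by rewrite normcM normc_real gtr0_norm.
lra.
Qed.

(** [cauchy_estimate] on the disc of radius r / 2 centred at a point of the segment
from 0 to h bounds the derivative there; [mean_value] integrates this bound. *)
Lemma schwarz_lemma phi (r M : R) h : 0 < r ->
  (forall w, normc w < r -> exists B, has_cderiv phi w B) ->
  (forall w, normc w < r -> normc (phi w) <= M) ->
  normc h <= r / 2 -> normc (phi h - phi 0) <= 8 * M / r * normc h.
Proof.
move=> r0 dphi phiM hr.
rewrite -{1}[h]add0r; apply: mean_value => u /andP[u0 u1].
rewrite add0r.
have uh : normc (u%:C * h) <= r / 2.
  rewrite normcM normc_real ger0_norm//; apply: le_trans hr.
  by rewrite ler_piMl// normc_ge0.
set c := u%:C * h in uh *.
have cr : normc c < r by apply: le_lt_trans uh _; lra.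
have [A hA] := dphi c cr.
exists A => //.
have inr w : normc w < r / 2 -> normc (w + c) < r.
  by move=> wr; have := normcD_le w c; lra.
have shift w B : has_cderiv phi (w + c) B -> has_cderiv (fun w => phi (w + c)) w B.
  move=> hB eta /hB[s s0 hs]; exists s => // w'.
  have -> : w' - w = (w' + c) - (w + c) by ring.
  exact: hs.
have -> : 8 * M / r = 2 * (2 * M) / (r / 2) by field; rewrite lt0r_neq0.
apply: (@cauchy_estimate (fun w => phi (w + c))).
- by rewrite divr_gt0.
- by move=> w /inr/dphi[B /shift hB]; exists B.
- move=> w wr; rewrite add0r.
  have := phiM _ (inr _ wr); have := phiM c cr.
  by have := normcB_le (phi (w + c)) (phi c); lra.
- by apply: shift; rewrite add0r.
Qed.

End SchwarzLemma.

(** * Summation over dyadic scales *)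

Section PowerGrowth.
Context {R : realType}.
Implicit Types (x y s : R).

Lemma ler_powR_neg x y s : 0 < x -> x <= y -> s <= 0 -> y `^ s <= x `^ s.
Proof.
move=> x0 xy s0; have y0 := lt_le_trans x0 xy.
rewrite -[s]opprK powRN [leRHS]powRN lef_pV2 ?posrE ?powR_gt0//.
by apply: (@ge0_ler_powR R (- s)) => //; rewrite ?nnegrE ?oppr_ge0// ltW.
Qed.

(** As s < 0, the errors A x^s at x, 2 x, 4 x, ... form a geometric series of ratio
2^s < 1. The hypotheses are required above a scale x0 only: in the
application h may leave the disc at smaller scales. *)
Lemma doubling_bound (G : R -> R) (x0 x1 A B s : R) :
  0 < x0 -> s < 0 -> 0 <= A -> 0 <= B ->
  (forall x, x0 <= x -> 2 * x <= x1 -> G x <= G (2 * x) + A * x `^ s) ->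
  (forall x, x0 <= x -> x1 < 2 * x -> x <= x1 -> G x <= B) ->
  forall x, x0 <= x <= x1 -> G x <= (A / (1 - 2 `^ s) + B / x1 `^ s) * x `^ s.
Proof.
move=> x00 s0 A0 B0 step base.
have two_s : 2 `^ s < 1.
  rewrite -[s]opprK powRN invf_lt1 ?powR_gt0//.
  apply: (@le_lt_trans _ _ (1 `^ (- s))); first by rewrite powR1.
  by apply: (@gt0_ltr_powR R (- s)); rewrite ?nnegrE ?oppr_gt0//; lra.
set K := A / (1 - 2 `^ s) + B / x1 `^ s.
(* K is chosen for this inequality, which closes the induction from 2 x to x. *)
have K_A : A + K * 2 `^ s <= K.
  suff : A <= K * (1 - 2 `^ s) by lra.
  by rewrite -ler_pdivrMr ?subr_gt0// /K lerDl divr_ge0 ?powR_ge0.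
have K0 : 0 <= K by rewrite /K addr_ge0// divr_ge0 ?powR_ge0// subr_ge0 ltW.
have top x : x0 <= x <= x1 -> x1 < 2 * x -> G x <= K * x `^ s.
  move=> /andP[x0x xx1] x2; have x_gt0 := lt_le_trans x00 x0x.
  have x1_gt0 := lt_le_trans x_gt0 xx1.
  apply: le_trans (base x x0x x2 xx1) _.
  apply: (@le_trans _ _ (K * x1 `^ s)); last first.
    by apply: ler_wpM2l => //; apply: ler_powR_neg => //; exact: ltW.
  rewrite -ler_pdivrMr ?powR_gt0// /K lerDr divr_ge0//.
  by rewrite subr_ge0 ltW.
have claim m : forall x, x0 <= x <= x1 -> x1 < 2 ^+ m.+1 * x -> G x <= K * x `^ s.
  elim: m => [|m IH] x xx hm; first by apply: top => //; rewrite -[2]expr1.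
  have [x2|x2] := lerP (2 * x) x1; last exact: top.
  case/andP: xx => x0x xx1; have x_gt0 := lt_le_trans x00 x0x.
  apply: le_trans (step x x0x x2) _.
  have /IH : x0 <= 2 * x <= x1 by rewrite x2 andbT; lra.
  rewrite mulrA -exprSr => /(_ hm); rewrite powRM ?(ltW x_gt0)// => h2.
  by have := powR_ge0 x s; nra.
move=> x xx; have x_gt0 : 0 < x by case/andP: xx => x0x _; exact: lt_le_trans x0x.
apply: (claim (Num.truncn (x1 / x))) => //; rewrite -ltr_pdivrMr//.
apply: lt_trans (truncnS_gt _) _.
by rewrite -natrX ltr_nat ltn_expl.
Qed.

End PowerGrowth.

(** * Increments along the tangential direction *)

Section EuclideanNorm.
Context {R : realType} {n : nat}.

Lemma enormZ (a : R[i]) (z : 'rV[R[i]]_n) : enorm (a *: z) = normc a * enorm z.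
Proof.
rewrite /enorm -(ger0_norm (normc_ge0 a)) -sqrtr_sqr -sqrtrM ?sqr_ge0//.
congr Num.sqrt; rewrite mulr_sumr; apply: eq_bigr => j _.
by rewrite mxE normcM exprMn.
Qed.

Lemma sub_translates (V : zmodType) (x y u v : V) :
  x - u + v - (x - y + v) = y - u.
Proof. by rewrite opprD addrACA subrr addr0 opprB addrC addrA subrK. Qed.

Lemma normc_le_sub (x y : R[i]) (b : R) :
  normc (x - y) <= b -> normc x <= normc y + b.
Proof.
move=> xyb; rewrite -[x](subrK y) addrC.
by apply: le_trans (normcD_le _ _) _; rewrite lerD2l.
Qed.

(** Serves twice: for two parallel discs, and with Q' = Q and L' = 0 for a single
disc. *)
Lemma schwarz_lines (Omega : set 'rV[R[i]]_n) (f : 'rV[R[i]]_n -> R[i])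
    (Q L Q' L' : 'rV[R[i]]_n) (r M : R) (h : R[i]) :
  holomorphic_on Omega f -> 0 < r ->
  (forall w, normc w < r -> Omega (Q + w *: L) /\ Omega (Q' + w *: L')) ->
  (forall w, normc w < r -> normc (f (Q + w *: L) - f (Q' + w *: L')) <= M) ->
  normc h <= r / 2 ->
  normc ((f (Q + h *: L) - f Q) - (f (Q' + h *: L') - f Q')) <= 8 * M / r * normc h.
Proof.
move=> hf r0 hO hM hr.
have -> : (f (Q + h *: L) - f Q) - (f (Q' + h *: L') - f Q') =
    (f (Q + h *: L) - f (Q' + h *: L')) - (f (Q + 0 *: L) - f (Q' + 0 *: L')).
  by rewrite !scale0r !addr0; ring.
apply: (@schwarz_lemma R (fun w => f (Q + w *: L) - f (Q' + w *: L'))) => //.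
move=> w /hO[in1 in2].
have [A hA] := has_cderiv_line (hf _ in1).
have [B hB] := has_cderiv_line (hf _ in2).
by exists (A - B); exact: has_cderivB.
Qed.

End EuclideanNorm.

Section DiscProperty.
Context {R : realType} {n : nat}.
Context (Omega : set 'rV[R[i]]_n) (f : 'rV[R[i]]_n -> R[i]).
Context (p N L : 'rV[R[i]]_n) (a alpha K c d0 : R).
Context (f_holo : holomorphic_on Omega f).
Context (f_lip : forall z w, Omega z -> Omega w ->
  normc (f z - f w) <= K * enorm (z - w) `^ alpha).
Context (alpha_gt0 : 0 < alpha) (alpha_lt : alpha < a).
Context (c_gt0 : 0 < c) (K_ge0 : 0 <= K).

Local Notation Q d := (p - d%:C *: N).

Context (discs : forall (d : R) w, 0 < d <= d0 -> normc w <= c * d `^ a ->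
  Omega (Q d + w *: L)).

Let a_gt0 : 0 < a := lt_trans alpha_gt0 alpha_lt.

Let radius_le (x y : R) : 0 < x -> x <= y -> c * x `^ a <= c * y `^ a.
Proof.
move=> x0 xy; rewrite ler_pM2l//.
by apply: ge0_ler_powR; rewrite ?nnegrE //; [exact: ltW..|lra].
Qed.

(** Both discs of radius c d^a, around Q d and around Q (2 * d), lie in Omega, and
corresponding points are at distance d |N|; so the difference of f on the two discs
is at most K (d |N|)^alpha. *)
Lemma increment_doubling (d : R) h : 0 < d -> 2 * d <= d0 ->
  normc h <= c * d `^ a / 2 ->
  normc (f (Q d + h *: L) - f (Q d)) <=
    normc (f (Q (2 * d) + h *: L) - f (Q (2 * d))) +
    8 * K * enorm N `^ alpha / c * normc h * d `^ (alpha - a).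
Proof.
move=> d_gt0 dd0 hh.
have r0 : 0 < c * d `^ a by rewrite mulr_gt0// powR_gt0.
have inO w : normc w < c * d `^ a ->
    Omega (Q d + w *: L) /\ Omega (Q (2 * d) + w *: L).
  move=> wr; split; apply: discs.
  - by apply/andP; split; lra.
  - exact: ltW.
  - by apply/andP; split; lra.
  - by apply: le_trans (ltW wr) _; apply: radius_le => //; lra.
have bound w : normc w < c * d `^ a ->
    normc (f (Q d + w *: L) - f (Q (2 * d) + w *: L)) <= K * (d * enorm N) `^ alpha.
  move=> /inO[in1 in2]; apply: le_trans (f_lip in1 in2) _.
  suff -> : Q d + w *: L - (Q (2 * d) + w *: L) = d%:C *: N.
    by rewrite enormZ normc_real gtr0_norm.
  by rewrite sub_translates -scalerBl -rmorphB; congr (_%:C *: _); ring.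
apply: normc_le_sub; apply: le_trans (schwarz_lines f_holo r0 inO bound hh) _.
have da0 : d `^ a != 0 by rewrite lt0r_neq0// powR_gt0.
rewrite powRM ?sqrtr_ge0 ?(ltW d_gt0)// powRB; last by rewrite lt0r_neq0// implybT.
move: (d `^ a) da0 => x x0.
by rewrite le_eqVlt; apply/orP; left; apply/eqP; field; rewrite x0 lt0r_neq0.
Qed.

(** For d comparable to d0 all radii are comparable, and a bound linear in h, with a
constant independent of d, suffices. It comes from the variation of f on
one disc alone. *)
Lemma increment_top (d : R) h : d0 / 2 < d -> d <= d0 ->
  normc h <= c * d `^ a / 2 ->
  normc (f (Q d + h *: L) - f (Q d)) <=
    8 * (K * (c * d0 `^ a * enorm L) `^ alpha) / (c * (d0 / 2) `^ a) * normc h.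
Proof.
move=> d2 dd0 hh.
have d_gt0 : 0 < d by lra.
have r0 : 0 < c * d `^ a by rewrite mulr_gt0// powR_gt0.
have inO w : normc w < c * d `^ a -> Omega (Q d + w *: L) /\ Omega (Q d + w *: 0).
  move=> wr; have d01 : 0 < d <= d0 by rewrite d_gt0.
  split; first by apply: discs => //; exact: ltW.
  by rewrite scaler0 -[0](scale0r L); apply: discs; rewrite // normc0 ltW.
have bound w : normc w < c * d `^ a -> normc (f (Q d + w *: L) - f (Q d + w *: 0)) <=
    K * (c * d0 `^ a * enorm L) `^ alpha.
  move=> wr; have [in1 in2] := inO w wr; apply: le_trans (f_lip in1 in2) _.
  rewrite scaler0 addr0 [_ + w *: L]addrC addrK enormZ ler_wpM2l//.
  have nL : 0 <= enorm L := sqrtr_ge0 _.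
  have c0 := ltW c_gt0.
  apply: (ge0_ler_powR (ltW alpha_gt0)); rewrite ?nnegrE.
  - by rewrite mulr_ge0// normc_ge0.
  - by rewrite !mulr_ge0// powR_ge0.
  apply: ler_wpM2r => //.
  by apply: le_trans (ltW wr) _; exact: radius_le.
have := schwarz_lines f_holo r0 inO bound hh.
rewrite scaler0 addr0 subrr subr0 => /le_trans; apply.
apply: ler_wpM2r; first exact: normc_ge0.
apply: ler_wpM2l; first by rewrite !mulr_ge0 ?powR_ge0.
rewrite lef_pV2 ?posrE ?mulr_gt0 ?powR_gt0//; last lra.
by apply: radius_le; lra.
Qed.

Lemma increment_bound : exists2 B : R, 0 <= B &
  forall (d : R) h, 0 < d <= d0 -> normc h <= c * d `^ a / 2 ->
    normc (f (Q d + h *: L) - f (Q d)) <= B * d `^ (alpha - a) * normc h.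
Proof.
pose A := 8 * K * enorm N `^ alpha / c.
pose T := 8 * (K * (c * d0 `^ a * enorm L) `^ alpha) / (c * (d0 / 2) `^ a).
have A0 : 0 <= A by rewrite /A divr_ge0 ?mulr_ge0 ?powR_ge0// ltW.
have T0 : 0 <= T by rewrite /T divr_ge0 ?mulr_ge0 ?powR_ge0// ltW.
have s0 : alpha - a < 0 by rewrite subr_lt0.
exists (A / (1 - 2 `^ (alpha - a)) + T / d0 `^ (alpha - a)).
  apply: addr_ge0; apply: divr_ge0 => //; last exact: powR_ge0.
  have := @ler_powR_neg R 1 2 _ ltr01 (ler1n _ 2) (ltW s0).
  by rewrite powR1 subr_ge0.
move=> d h /andP[d_gt0 dd0] hh.
have hx x : d <= x -> normc h <= c * x `^ a / 2.
  by move=> dx; apply: le_trans hh _; rewrite ler_pM2r//; exact: radius_le.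
have := @doubling_bound R (fun x => normc (f (Q x + h *: L) - f (Q x))) d d0
  (A * normc h) (T * normc h) (alpha - a) d_gt0 s0
  (mulr_ge0 A0 (normc_ge0 h)) (mulr_ge0 T0 (normc_ge0 h)).
have -> : (A / (1 - 2 `^ (alpha - a)) + T / d0 `^ (alpha - a)) *
    d `^ (alpha - a) * normc h =
  (A * normc h / (1 - 2 `^ (alpha - a)) + T * normc h / d0 `^ (alpha - a)) *
    d `^ (alpha - a) by ring.
apply; last by rewrite lexx.
- by move=> x dx x2; apply: increment_doubling => //; [lra|exact: hx].
- by move=> x dx x1 x2; apply: increment_top => //; [lra|exact: hx].
Qed.

End DiscProperty.

(** The hypothesis x <= c d^(1/k) reads (x / c)^k <= d, and the exponent
alpha - 1/k is negative. *)
Lemma scale_comparison (R : realType) (k : nat) (c d x alpha : R) :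
  (0 < k)%N -> 0 < alpha -> alpha < k%:R^-1 -> 0 < c -> 0 < d -> 0 < x ->
  x <= c * d `^ k%:R^-1 ->
  d `^ (alpha - k%:R^-1) * x <= c `^ (1 - k%:R * alpha) * x `^ (k%:R * alpha).
Proof.
move=> k0 alpha0 alphak c0 d0 x0 xd.
have k0' : 0 < k%:R :> R by rewrite ltr0n.
pose y := x / c; have y0 : 0 < y by rewrite divr_gt0.
have -> : x = y * c by rewrite divfK ?lt0r_neq0.
have yd : y `^ k%:R <= d.
  have -> : d = (d `^ k%:R^-1) `^ k%:R.
    by rewrite -powRrM mulVf ?lt0r_neq0// powRr1// ltW.
  apply: (ge0_ler_powR (ltW k0')); rewrite ?nnegrE ?powR_ge0 ?(ltW y0)//.
  by rewrite ler_pdivrMr// mulrC.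
have s0 : alpha - k%:R^-1 <= 0 by rewrite subr_le0 ltW.
have := ler_powR_neg (powR_gt0 _ y0) yd s0.
rewrite -powRrM mulrBr mulfV ?lt0r_neq0// => h.
apply: le_trans (ler_wpM2r (ltW (mulr_gt0 y0 c0)) h) _.
rewrite mulrA [_ * y]mulrC mulr_powRB1 ?(ltW y0)// ?mulr_gt0//.
rewrite powRM ?(ltW y0) ?(ltW c0)// mulrCA -powRD ?lt0r_neq0 ?implybT//.
by rewrite subrK powRr1// ltW.
Qed.

Theorem theorem1p1 (R : realType) (n : nat) (hn : (2 <= n)%N)
    (Omega : set 'rV[R[i]]_n)
    (Omega_domain : domain Omega)
    (Omega_bounded : bounded_set Omega)
    (Omega_C1 : C1_boundary Omega)
    (p N L : 'rV[R[i]]_n)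
    (hp : boundary Omega p)
    (hN : unit_outward_normal Omega p N)
    (hL : unit_complex_tangential Omega p L)
    (k : nat) (hk : (0 < k)%N)
    (hdisc : disc_property k Omega p N L)
    (alpha : R) (halpha : 0 < alpha < k%:R^-1)
    (f : 'rV[R[i]]_n -> R[i])
    (f_holo : holomorphic_on Omega f)
    (f_lip : lipschitz_of_order alpha Omega f) :
  exists c C : R, [/\ 0 < c, 0 < C &
    \forall delta \near (0 : R)^'+, forall h : R[i],
      normc h < c * delta `^ k%:R^-1 / 10 ->
      let Q := p - delta%:C *: N in
      [/\ Omega Q, Omega (Q + h *: L) &
          normc (f Q - f (Q + h *: L)) <= C * normc h `^ (k%:R * alpha)]].
Proof.
have [K0 lipK0] := f_lip; have [d0 [c1 [c [d0_gt0 c1_gt0 c_gt0 hd]]]] := hdisc.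
have /andP[alpha_gt0 alpha_lt] := halpha.
pose K := Num.max K0 0; have K_ge0 : 0 <= K by rewrite le_max lexx orbT.
have lipK z w : Omega z -> Omega w ->
    normc (f z - f w) <= K * enorm (z - w) `^ alpha.
  move=> Oz Ow; apply: le_trans (lipK0 z w Oz Ow) _.
  by rewrite ler_wpM2r ?powR_ge0// le_max lexx.
have discs (d : R) w : 0 < d <= d0 -> normc w <= c * d `^ k%:R^-1 ->
    Omega (p - d%:C *: N + w *: L).
  move=> /[dup] dd0 /andP[d_gt0 _] wd; apply: (hd d dd0).
  exists (0, w); last by rewrite /= scale0r subr0.
  split; last exact: wd.
  by rewrite [X in normc X]/= normc0 mulr_ge0// ltW.
have [B B_ge0 hB] := increment_bound f_holo lipK alpha_gt0 alpha_lt c_gt0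
  K_ge0 discs.
exists c, (B * c `^ (1 - k%:R * alpha) + 1); split => //.
  by rewrite ltr_wpDl// mulr_ge0// powR_ge0.
near=> delta => h hh.
have d_gt0 : 0 < delta by near: delta; exact: nbhs_right_gt.
have dd0 : 0 < delta <= d0 by rewrite d_gt0; near: delta; exact: nbhs_right_le.
have r_gt0 : 0 < c * delta `^ k%:R^-1 by rewrite mulr_gt0// powR_gt0.
split.
- by have := discs delta 0 dd0; rewrite scale0r addr0 normc0; apply; exact: ltW.
- by apply: discs => //; lra.
have [->|h0] := eqVneq h 0.
  by rewrite scale0r addr0 subrr normc0 mulr_ge0 ?powR_ge0// addr_ge0// mulr_ge0// powR_ge0.
have nh0 : 0 < normc h.
  by rewrite lt_def normc_ge0 andbT; apply: contra_neq h0 => /eq0_normc.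
rewrite normc_sub; apply: le_trans (hB _ _ dd0 _) _; first lra.
apply: (@le_trans _ _ (B * c `^ (1 - k%:R * alpha) * normc h `^ (k%:R * alpha))).
  rewrite -!mulrA ler_wpM2l//; apply: scale_comparison => //; lra.
by rewrite ler_wpM2r ?powR_ge0// lerDl.
Unshelve. all: by end_near.
Qed.
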